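(* Let $X,Y,W,H$ be real Hilbert spaces, $B\in\mathcal L(X,Y')$, $C\in\mathcal L(X,W)$, $L\in\mathcal L(X,H)$, with $(B,C,L)\colon X\to Y'\times W\times H$ injective. Let $(X^\delta)_{\delta\in\Delta}$ and $(Y^\delta)_{\delta\in\Delta}$ be families of finite dimensional subspaces of $X$ and $Y$, respectively, with $$\varrho:=\inf_{\delta\in\Delta}\ \inf_{\{z\in X^\delta\colon Bz\ne0\}}\ \sup_{0\ne v\in Y^\delta}\frac{|(Bz)(v)|}{\|Bz\|_{Y'}\|v\|_Y}>0,$$ and for each $\delta\in\Delta$ let $\langle\cdot,\cdot\rangle_{Y^\delta}$ be an inner product on $Y^\delta$ whose associated norm $\|\cdot\|_{Y^\delta}$ is equivalent to $\|\cdot\|_Y$ on $Y^\delta$, uniformly in $\delta\in\Delta$. Then for all $\delta\in\Delta$, $\varepsilon>0$, $g\in Y'$, and $h\in W$, there is a unique minimizer $$u_\varepsilon^\delta:=\operatorname*{argmin}_{z\in X^\delta}\Big\{\sup_{0\ne v\in Y^\delta}\frac{|(Bz-g)(v)|^2}{\|v\|_{Y^\delta}^2}+\|Cz-h\|_W^2+\varepsilon^2\|Lz\|_H^2\Big\},$$ and there exists a constant $K$, independent of $\delta\in\Delta$, $\varepsilon>0$, $g\in Y'$, $h\in W$, and $u\in X$, such that for every $u\in X$ $$|||u-u_\varepsilon^\delta|||_\varepsilon\le K\Big(\|Bu-g\|_{Y'}+\|Cu-h\|_W+\min_{z\in X^\delta}|||u-z|||_\varepsilon+\varepsilon\|Lu\|_H\Big).$$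 Consequently, with $V:=Y'\times W$, $A:=(B,C)$, $f:=(g,h)$, there is a constant $K'$, with the same independence and also independent of $\tau$, such that whenever $\|f-Au\|_V\le\tau$, $$|||u-u_\varepsilon^\delta|||_\varepsilon\le K'\Big(\tau+\min_{z\in X^\delta}|||u-z|||_\varepsilon+\varepsilon\|Lu\|_H\Big).$$
   Context: For $\varepsilon>0$, the norm $|||\cdot|||_\varepsilon$ on $X$ is defined by $$|||z|||_\varepsilon:=\sqrt{\|Bz\|_{Y'}^2+\|Cz\|_W^2+\varepsilon^2\|Lz\|_H^2}.$$ $Y'$ is the dual of $Y$ with the dual norm $\|g\|_{Y'}=\sup_{0\ne v\in Y}|g(v)|/\|v\|_Y$; $V=Y'\times W$ carries the Hilbert product norm $\|(g,h)\|_V^2=\|g\|_{Y'}^2+\|h\|_W^2$. $\mathcal L(E,F)$ denotes the space of bounded linear maps $E\to F$. ''Equivalent uniformly in $\delta$'' means that there are constants $0<c\le C_0<\infty$ with $c\|v\|_Y\le\|v\|_{Y^\delta}\le C_0\|v\|_Y$ for all $v\in Y^\delta$ and all $\delta\in\Delta$. *)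

(* Defs.v *)
From HB Require Import structures.
From mathcomp Require Import all_boot all_order all_algebra.
From mathcomp Require Import all_classical all_reals all_analysis.

Set Implicit Arguments.
Unset Strict Implicit.
Unset Printing Implicit Defensive.

Import Order.TTheory GRing.Theory Num.Theory.
Import numFieldNormedType.Exports.

Local Open Scope classical_set_scope.
Local Open Scope ring_scope.

(* A real Hilbert space is a complete normed module whose norm is induced by
   an inner product. *)
HB.mixin Record CompleteNormedModule_isHilbert (R : realType) V
    of CompleteNormedModule R V := {
  inner : {dot V for (@idfun R)};
  norm_inner : forall x : V, `|x| = Num.sqrt (inner x x)
}.

#[short(type="hilbertType")]
HB.structure Definition Hilbert (R : realType) :=
  {V of CompleteNormedModule R V & CompleteNormedModule_isHilbert R V}.

Section BoundedLinear.
Variables (R : realType) (E F : normedModType R).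

Definition bounded_linear_pred : {pred E -> F} :=
  mem [set f : E -> F | linear f /\ exists M : R, forall x, `|f x| <= M * `|x|].

Record bounded_linear := BoundedLinear {
  bounded_linear_fun :> E -> F;
  bounded_linearP : bounded_linear_fun \in bounded_linear_pred
}.

HB.instance Definition _ := [isSub for bounded_linear_fun].
HB.instance Definition _ := [Choice of bounded_linear by <:].

Lemma bounded_linear_submod_closed : submod_closed bounded_linear_pred.
Proof.
split.
  rewrite inE; split; first by move=> a x y /=; rewrite scaler0 addr0.
  by exists 0 => x; rewrite normr0 mul0r.
move=> a f g; rewrite !inE => -[lf [Mf bf]] [lg [Mg bg]]; split.
  move=> b x y; rewrite !fctE lf lg !scalerDr !scalerA (mulrC a).
  by rewrite addrACA.
exists (`|a| * Mf + Mg) => x; rewrite !fctE mulrDl.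
by rewrite (le_trans (ler_normD _ _))// lerD// normrZ -mulrA ler_wpM2l.
Qed.

HB.instance Definition _ :=
  GRing.isSubmodClosed.Build R (E -> F) bounded_linear_pred
    bounded_linear_submod_closed.

HB.instance Definition _ := [SubChoice_isSubLmodule of bounded_linear by <:].

Lemma bounded_linear_is_linear (f : bounded_linear) : linear f.
Proof. by case: f => f /= /set_mem[]. Qed.

HB.instance Definition _ (f : bounded_linear) :=
  GRing.isLinear.Build R E F *:%R f (bounded_linear_is_linear f).

(* If [E] is the zero space, the set is empty and [sup set0 = 0]; otherwise it
   is nonempty and bounded, see [op_norm_has_sup]. *)
Definition op_norm (f : bounded_linear) : R :=
  sup [set `|f x| / `|x| | x in [set x : E | x != 0]].

Lemma op_norm_has_ubound (f : bounded_linear) :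
  has_ubound [set `|f x| / `|x| | x in [set x : E | x != 0]].
Proof.
case: f => f /= /set_mem[_ [M fM]]; exists M => _ /= [x x0 <-].
by rewrite ler_pdivrMr ?normr_gt0.
Qed.

Lemma op_norm_ge0 (f : bounded_linear) : 0 <= op_norm f.
Proof.
rewrite /op_norm; have [->|/set0P[y Sy]] :=
  eqVneq [set `|f x| / `|x| | x in [set x : E | x != 0]] set0.
  by rewrite sup0.
apply: le_trans (ub_le_sup (op_norm_has_ubound f) Sy).
by case: Sy => x _ <-; rewrite divr_ge0.
Qed.

Lemma op_normP (f : bounded_linear) x : `|f x| <= op_norm f * `|x|.
Proof.
have [->|x0] := eqVneq x 0; first by rewrite linear0 !normr0 mulr0.
rewrite -ler_pdivrMr ?normr_gt0//.
by apply: (ub_le_sup (op_norm_has_ubound f)); exists x.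
Qed.

Lemma op_norm_le (f : bounded_linear) M :
  0 <= M -> (forall x, `|f x| <= M * `|x|) -> op_norm f <= M.
Proof.
move=> M0 fM; rewrite /op_norm.
have [->|/set0P S0] :=
  eqVneq [set `|f x| / `|x| | x in [set x : E | x != 0]] set0.
  by rewrite sup0.
apply: ge_sup => // _ [x /= x0 <-].
by rewrite ler_pdivrMr ?normr_gt0.
Qed.

Let op_normD (f g : bounded_linear) : op_norm (f + g) <= op_norm f + op_norm g.
Proof.
apply: op_norm_le => [|x]; first by rewrite addr_ge0// op_norm_ge0.
by rewrite mulrDl (le_trans (ler_normD _ _))// lerD// op_normP.
Qed.

Let op_normZ (a : R) (f : bounded_linear) : op_norm (a *: f) = `|a| * op_norm f.
Proof.
have le b (h : bounded_linear) : op_norm (b *: h) <= `|b| * op_norm h.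
  apply: op_norm_le => [|x]; first by rewrite mulr_ge0// op_norm_ge0.
  by rewrite [_ x]/(b *: h x) normrZ -mulrA ler_wpM2l// op_normP.
apply/eqP; rewrite eq_le le/=.
have [->|a0] := eqVneq a 0; first by rewrite normr0 mul0r op_norm_ge0.
rewrite -{1}[f](scalerK a0) -ler_pdivlMl ?normr_gt0//.
by rewrite -normfV; exact: le.
Qed.

Let op_norm_eq0 (f : bounded_linear) : op_norm f = 0 -> f = 0.
Proof.
move=> f0; apply/val_inj/funext => x /=; apply/normr0_eq0/le_anti.
by rewrite normr_ge0 (le_trans (op_normP f x))// f0 mul0r.
Qed.

HB.instance Definition _ := Lmodule_isNormed.Build R bounded_linear
  op_normD op_normZ op_norm_eq0.

End BoundedLinear.

Notation "''L' ( E , F )" := (bounded_linear E F)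
  (at level 8, format "''L' ( E ,  F )") : type_scope.

Definition dual (R : realType) (Y : normedModType R) := 'L(Y, R^o).
HB.instance Definition _ (R : realType) (Y : normedModType R) :=
  NormedModule.on (dual Y).

(* Hilbert product norm on V = Y' x W; the library norm on pairs is the
   maximum norm. *)
Definition pair_norm (R : realType) (E F : normedModType R) (p : E * F) : R :=
  Num.sqrt (`|p.1| ^+ 2 + `|p.2| ^+ 2).

Section Subspaces.
Variables (R : realType) (E : lmodType R).

Definition findim_subspace (S : set E) : Prop :=
  submod_closed (mem S) /\
  exists (n : nat) (e : 'I_n -> E),
    forall x, S x -> exists c : 'I_n -> R, x = \sum_i c i *: e i.

(* [ip] is constrained on [S] only. *)
Definition inner_product_on (S : set E) (ip : E -> E -> R) : Prop :=
  [/\ {in S &, forall u v, ip u v = ip v u},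
      {in S & &, forall u v w, forall a, ip (a *: u + v) w = a * ip u w + ip v w}
    & {in S, forall u, u != 0 -> 0 < ip u u}].

Definition ip_norm (ip : E -> E -> R) (v : E) : R := Num.sqrt (ip v v).

End Subspaces.

Definition argmin_on (R : realType) (T : Type) (S : set T) (J : T -> R) : set T :=
  [set z | S z /\ forall z', S z' -> J z <= J z'].

Definition is_min (R : realType) (S : set R) (m : R) : Prop := S m /\ lbound S m.

Section Problem.
Variables (R : realType) (X Y W H : hilbertType R).
Variables (B : 'L(X, dual Y)) (C : 'L(X, W)) (L : 'L(X, H)).

Definition energy_norm (eps : R) (z : X) : R :=
  Num.sqrt (`|B z| ^+ 2 + `|C z| ^+ 2 + eps ^+ 2 * `|L z| ^+ 2).

Definition nonzero (S : set Y) : set Y := S `&` [set v | v != 0].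

(* The infimum over an empty set is +oo.  The supremum over an empty set is -oo;
   reading it as 0 instead does not affect whether [0 < varrho]. *)
Definition varrho (Delta : Type) (Xd : Delta -> set X) (Yd : Delta -> set Y)
    : \bar R :=
  ereal_inf [set ereal_inf [set ereal_sup
      [set (`|B z v| / (`|B z| * `|v|))%:E | v in nonzero (Yd d)]
    | z in Xd d `&` [set z | B z != 0]] | d in [set: Delta]].

(* [sup set0 = 0], so the first term vanishes when [Yd] is the zero space. *)
Definition objective (Yd : set Y) (ip : Y -> Y -> R) (eps : R) (g : dual Y)
    (h : W) (z : X) : R :=
  sup [set `|(B z - g) v| ^+ 2 / ip_norm ip v ^+ 2 | v in nonzero Yd]
  + `|C z - h| ^+ 2 + eps ^+ 2 * `|L z| ^+ 2.

End Problem.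

(* Main.v *)
Require Import Defs.
From mathcomp Require Import all_boot all_order all_algebra.
From mathcomp Require Import all_classical all_reals all_analysis.
From mathcomp Require Import ring lra.

Import Order.TTheory GRing.Theory Num.Theory.
Import numFieldNormedType.Exports.

Local Open Scope classical_set_scope.
Local Open Scope ring_scope.

(** Put [iota z := (B z, C z, eps *: L z)], a linear map from [X] to
    [Y' x W x H].  The energy norm of [z] is the norm [N] of [iota z] in the
    product, and the objective at [z] is the square of [Nd (p - iota z)], where
    [p := (g, h, 0)] and [Nd] is the same product seminorm with the dual norm on
    [Y'] replaced by the seminorm which only tests against the discrete space
    [Yd], measured in its own norm.  So the minimizer [ud] and the best energy
    approximation [t] of [u] are both best approximations from the
    finite-dimensional space [S := iota Xd], for two seminorms.

    Existence: a best approximation from a finite-dimensional subspace exists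
    for every seminorm ([best_approximation]).

    Uniqueness: [Nd] satisfies the parallelogram inequality, so two best
    approximations are at [Nd]-distance 0.  For the discrete dual seminorm this
    inequality follows from the parallelogram law on [Yd] by duality
    ([dual_seminorm_hilbertian]).  The inf-sup
    condition makes [Nd] dominate [N] on [S], and [N \o iota] is a norm
    because [(B, C, L)] is injective.

    Error bound: the norm equivalence gives [Nd <= lam * N] everywhere, and the
    inf-sup condition gives [N <= kap * Nd] on [S].  Writing [s := iota ud],
    and identifying [u] and [t] with their images,
      [N (u - s) <= N (u - t) + kap * Nd (t - s)], and
      [Nd (t - s) <= Nd (t - p) + Nd (p - s) <= 2 * Nd (p - t)
         <= 2 * lam * (N (p - u) + N (u - t))],
    where the middle step is the minimality of [s].  This is
    [quasi_best_approximation]; the constants [kap = 1 + C0 / r] and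
    [lam = 1 + 1 / c] depend only on the inf-sup constant and on the norm
    equivalence, hence are uniform in all the data.  Finally [N (p - u)] is at
    most the sum of the data misfit and of [eps * `|L u|]. *)

(** * Seminorms and their Euclidean sums *)

Section Seminorms.
Set Implicit Arguments.
Unset Strict Implicit.
Variable R : realType.

Definition seminorm (E : lmodType R) (N : E -> R) : Prop :=
  (forall x y, N (x + y) <= N x + N y) /\ (forall a x, N (a *: x) = `|a| * N x).

(** One inequality is enough: applied to [x + y] and [x - y] it gives the
    reverse one, so this is the full parallelogram law for a seminorm. *)
Definition hilbertian (E : lmodType R) (N : E -> R) : Prop :=
  forall x y, N (x + y) ^+ 2 + N (x - y) ^+ 2 <= 2 * (N x ^+ 2 + N y ^+ 2).

Definition l2_sum (E F : lmodType R) (N : E -> R) (M : F -> R) (p : E * F) : R :=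
  Num.sqrt (N p.1 ^+ 2 + M p.2 ^+ 2).

Section SeminormTheory.
Variables (E : lmodType R) (N : E -> R).
Hypothesis N_seminorm : seminorm N.

Lemma seminormD x y : N (x + y) <= N x + N y.
Proof. by case: N_seminorm. Qed.

Lemma seminormZ a x : N (a *: x) = `|a| * N x.
Proof. by case: N_seminorm. Qed.

Lemma seminormN x : N (- x) = N x.
Proof. by rewrite -scaleN1r seminormZ normrN1 mul1r. Qed.

Lemma seminorm0 : N 0 = 0.
Proof. by rewrite -(scale0r 0) seminormZ normr0 mul0r. Qed.

Lemma seminorm_ge0 x : 0 <= N x.
Proof. by have := seminormD x (- x); rewrite subrr seminorm0 seminormN; lra. Qed.

Lemma seminormC x y : N (x - y) = N (y - x).
Proof. by rewrite -seminormN opprB. Qed.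

Lemma seminorm_trans y x z : N (x - z) <= N (x - y) + N (y - z).
Proof. by have := seminormD (x - y) (y - z); rewrite addrA subrK. Qed.

Lemma ler_seminormB x y : N x - N y <= N (x - y).
Proof. by rewrite lerBlDr -{1}(subrK y x) seminormD. Qed.

End SeminormTheory.

Lemma normr_seminorm (E : normedModType R) : seminorm (fun x : E => `|x|).
Proof. by split; [exact: ler_normD|exact: normrZ]. Qed.

(** Minkowski's inequality in the plane. *)
Lemma sqrt_sum_sqrD (a b a' b' : R) :
  Num.sqrt ((a + a') ^+ 2 + (b + b') ^+ 2) <=
  Num.sqrt (a ^+ 2 + b ^+ 2) + Num.sqrt (a' ^+ 2 + b' ^+ 2).
Proof.
have ge0 (x y : R) : 0 <= x ^+ 2 + y ^+ 2 by rewrite addr_ge0 ?sqr_ge0.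
rewrite -(ler_pXn2r (ltn0Sn 1)) ?nnegrE ?addr_ge0 ?sqrtr_ge0//.
rewrite [leRHS]sqrrD !sqr_sqrtr// -sqrtrM//.
suff : a * a' + b * b' <= Num.sqrt ((a ^+ 2 + b ^+ 2) * (a' ^+ 2 + b' ^+ 2)).
  by move: (Num.sqrt _) => s; lra.
(* Cauchy-Schwarz, through Lagrange's identity. *)
rewrite (le_trans (ler_norm _))// -sqrtr_sqr ler_sqrt ?mulr_ge0//.
by have := sqr_ge0 (a * b' - b * a'); nra.
Qed.

Lemma l2_sum_seminorm (E F : lmodType R) (N : E -> R) (M : F -> R) :
  seminorm N -> seminorm M -> seminorm (l2_sum N M).
Proof.
move=> sN sM; split=> [[x x'] [y y']|a [x x']]; rewrite /l2_sum /=.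
  apply: le_trans (sqrt_sum_sqrD _ _ _ _).
  rewrite ler_sqrt ?addr_ge0 ?sqr_ge0//.
  by rewrite lerD// ler_pXn2r ?nnegrE ?addr_ge0 ?(seminorm_ge0 sN)
    ?(seminorm_ge0 sM) ?(seminormD sN) ?(seminormD sM).
rewrite (seminormZ sN) (seminormZ sM) !exprMn -mulrDr sqrtrM ?sqr_ge0//.
by rewrite sqrtr_sqr normr_id.
Qed.

Lemma l2_sum_hilbertian (E F : lmodType R) (N : E -> R) (M : F -> R) :
  hilbertian N -> hilbertian M -> hilbertian (l2_sum N M).
Proof.
move=> hN hM [x x'] [y y']; rewrite /l2_sum /= !sqr_sqrtr ?addr_ge0 ?sqr_ge0//.
by have := hN x y; have := hM x' y'; lra.
Qed.

Lemma l2_sum_le (E F : lmodType R) (N N' : E -> R) (M M' : F -> R) (k : R) x y :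
  0 <= k -> 0 <= N x -> 0 <= M y -> N x <= k * N' x -> M y <= k * M' y ->
  l2_sum N M (x, y) <= k * l2_sum N' M' (x, y).
Proof.
move=> k0 Nx0 My0 leN leM; rewrite /l2_sum /=.
rewrite -[X in _ <= X * _](ger0_norm k0) -sqrtr_sqr -sqrtrM ?sqr_ge0//.
rewrite ler_sqrt ?mulr_ge0 ?addr_ge0 ?sqr_ge0// mulrDr -!exprMn.
by rewrite lerD// ler_pXn2r ?nnegrE// (le_trans _ leN, le_trans _ leM).
Qed.

Lemma l2_sum_eq0 (E F : lmodType R) (N : E -> R) (M : F -> R) p :
  l2_sum N M p = 0 -> N p.1 = 0 /\ M p.2 = 0.
Proof.
move=> /eqP; rewrite sqrtr_eq0 => le0.
have : N p.1 ^+ 2 + M p.2 ^+ 2 == 0.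
  by rewrite eq_le le0 addr_ge0 ?sqr_ge0.
by rewrite paddr_eq0 ?sqr_ge0// !sqrf_eq0 => /andP[/eqP-> /eqP->].
Qed.

Lemma l2_sum_le_add (E F : lmodType R) (N : E -> R) (M : F -> R) p :
  0 <= N p.1 -> 0 <= M p.2 -> l2_sum N M p <= N p.1 + M p.2.
Proof.
move=> N0 M0; rewrite -[leRHS]ger0_norm ?addr_ge0// -sqrtr_sqr.
by rewrite ler_sqrt ?sqr_ge0// sqrrD addrAC lerDl mulrn_wge0 ?mulr_ge0.
Qed.

Lemma pair_norm_ge (E F : normedModType R) (x : E) (y : F) :
  `|x| <= pair_norm (x, y) /\ `|y| <= pair_norm (x, y).
Proof.
have le (a b : R) : 0 <= a -> a <= Num.sqrt (a ^+ 2 + b ^+ 2).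
  move=> a0; rewrite -{1}(ger0_norm a0) -sqrtr_sqr ler_sqrt ?addr_ge0 ?sqr_ge0//.
  by rewrite lerDl sqr_ge0.
by split; rewrite /pair_norm/= ?le// addrC le.
Qed.

Lemma hilbert_norm_hilbertian (V : hilbertType R) :
  hilbertian (fun x : V => `|x|).
Proof.
have sq (z : V) : `|z| ^+ 2 = inner z z.
  rewrite norm_inner sqr_sqrtr//.
  have [->|z0] := eqVneq z 0; first by rewrite linear0l.
  exact/ltW/neq0_dnorm_gt0.
have Dl (x y z : V) : inner (x + y) z = inner x z + inner y z.
  exact: linearDl.
have Bl (x y z : V) : inner (x - y) z = inner x z - inner y z.
  exact: linearBl.
have Dr (x y z : V) : inner z (x + y) = inner z x + inner z y.
  exact: linearDr.
have Br (x y z : V) : inner z (x - y) = inner z x - inner z y.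
  exact: linearBr.
by move=> x y; rewrite !sq Bl !Br Dl !Dr; lra.
Qed.

End Seminorms.

(** * Best approximation from a finite-dimensional subspace *)

Section BestApproximation.
Set Implicit Arguments.
Unset Strict Implicit.
Variable R : realType.

(** Coercivity confines the minimization to a compact interval, on which the
    continuous function [f] attains its minimum. *)
Lemma lipschitz_coercive_min (f : R -> R) (k M : R) : 0 < k ->
  (forall x y, `|f x - f y| <= k * `|x - y|) ->
  (forall x, k * `|x| - M <= f x) ->
  exists x, forall y, f x <= f y.
Proof.
move=> k0 flip fcoer.
(* Outside [[-r, r]] the lower bound already exceeds [f 0]. *)
pose r := (`|f 0| + `|M|) / k.
have r0 : 0 <= r by rewrite divr_ge0 ?addr_ge0// ltW.
have fcont : continuous f.
  move=> x; apply/cvgrPdist_lt => e e0; near=> t.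
  rewrite (le_lt_trans (flip _ _))// mulrC -ltr_pdivlMr//.
  by near: t; apply: cvgr_dist_lt => //; rewrite divr_gt0.
have [||x _ xmin] := @EVT_min _ f (- r) r.
- by rewrite ge0_cp.
- exact: continuous_subspaceT.
exists x => y; have [yr|yr] := leP `|y| r.
  by apply: xmin; rewrite in_itv /= -ler_norml.
have f0 : f x <= f 0 by apply: xmin; rewrite in_itv /= oppr_le0 r0.
apply: (le_trans f0); apply: le_trans (fcoer y).
have : `|f 0| + `|M| <= k * `|y| by rewrite mulrC -ler_pdivrMr// ltW.
by have := ler_norm (f 0); have := ler_norm M; lra.
Unshelve. all: by end_near. Qed.

Variables (E : lmodType R) (N : E -> R).
Hypothesis N_seminorm : seminorm N.

(** By induction on the number of vectors spanning a space that contains [S].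
    Unless the last vector can be dropped, [S] is the sum of a smaller subspace
    [S'] and of a line spanned by some [y].  Choosing [y] with best
    approximation 0 in [S'] makes [N (b *: y + s)] at least [`|b| * N y] on
    [S'], so the distance from [p - b *: y] to [S'] is a coercive Lipschitz
    function of [b], and minimizing it reduces to one real variable.  When
    [N y = 0] this distance is constant in [b]. *)
Lemma best_approximation (S : set E) (p : E) : findim_subspace S ->
  exists s, argmin_on S (fun s => N (p - s)) s.
Proof.
move=> [+ [n [e]]]; elim: n => [|n IHn] in S e p *; move=> Ssub Sspan.
  have [S0 _] := Ssub; rewrite inE in S0.
  exists 0; split=> // s /Sspan[c ->].
  by rewrite big_ord0.
have S0 : S 0 by case: Ssub; rewrite inE.
have SP a x y : S x -> S y -> S (a *: x + y).
  by case: Ssub => _ /(_ a x y); rewrite !inE; exact.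
pose e' (i : 'I_n) := e (widen_ord (leqnSn n) i).
pose S' := S `&` [set x | exists c : 'I_n -> R, x = \sum_i c i *: e' i].
have S'sub : submod_closed (mem S').
  split=> [|a x y].
    rewrite inE; split=> //; exists (fun=> 0).
    by rewrite big1// => i _; rewrite scale0r.
  rewrite !inE => -[Sx [c xc]] [Sy [d yd]].
  split; first exact: SP.
  exists (fun i => a * c i + d i).
  rewrite xc yd scaler_sumr -big_split/=; apply: eq_bigr => i _.
  by rewrite scalerDl scalerA.
have IH q : exists s, argmin_on S' (fun s => N (q - s)) s.
  by apply: (IHn _ e') => // x [].
have [SS'|/existsNP[x /not_implyP[Sx S'x]]] := pselect (S `<=` S').
  have [s [[Ss _] smin]] := IH p.
  by exists s; split=> // s' /SS'; exact: smin.
have [z [S'z zmin]] := IH x.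
pose y := x - z.
have Sy : S y by rewrite /y addrC -scaleN1r; apply: SP => //; case: S'z.
(* Subtract the multiple of [x] that cancels the last coordinate of [t]; since
   [z] lies in [S'], the same multiple of [y] works. *)
have yline t : S t -> exists b, S' (t - b *: y).
  have [c xc] := Sspan _ Sx.
  have c0 : c ord_max != 0.
    apply: contra_notN S'x => /eqP c0; split=> //.
    exists (fun i => c (widen_ord (leqnSn n) i)).
    by rewrite xc big_ord_recr/= c0 scale0r addr0.
  move=> St; have [d td] := Sspan _ St; pose b := d ord_max / c ord_max.
  exists b; have -> : t - b *: y = b *: z + (t - b *: x).
    by rewrite /y scalerBr opprB addrCA addrC.
  have [_ +] := S'sub => /(_ b z (t - b *: x)); rewrite !inE; apply=> //.
  split; first by rewrite addrC -scaleNr; exact: SP.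
  exists (fun i => d (widen_ord (leqnSn n) i) - b * c (widen_ord (leqnSn n) i)).
  rewrite td xc !big_ord_recr/= scalerDr scalerA divfK// opprD addrACA.
  rewrite subrr addr0 scaler_sumr -sumrB; apply: eq_bigr => i _.
  by rewrite scalerBl scalerA.
have ydist b s : S' s -> `|b| * N y <= N (b *: y + s).
  move=> S's; have [->|b0] := eqVneq b 0.
    by rewrite normr0 mul0r (seminorm_ge0 N_seminorm).
  have -> : b *: y + s = b *: (x - (z - b^-1 *: s)).
    rewrite opprB addrCA [RHS]scalerDr scalerA divff// scale1r.
    exact: addrC.
  rewrite (seminormZ N_seminorm) ler_wpM2l// zmin//.
  have [_ +] := S'sub => /(_ (- b^-1) s z); rewrite !inE scaleNr addrC.
  exact.
have [best best_min] := choice (fun b => IH (p - b *: y)).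
pose f b := N (p - b *: y - best b).
suff [b bmin] : exists b, forall b', f b <= f b'.
  exists (b *: y + best b); split.
    by apply: SP => //; case: (best_min b) => -[].
  move=> s Ss; have [b' S's] := yline _ Ss.
  rewrite opprD addrA (le_trans (bmin b'))//.
  have -> : p - s = p - b' *: y - (s - b' *: y) by rewrite opprB addrA subrK.
  by have [_] := best_min b'; exact.
have fle b b' : f b <= f b' + `|b - b'| * N y.
  have [_ /(_ (best b'))] := best_min b.
  have [S'b _] := best_min b' => /(_ S'b)/le_trans; apply.
  rewrite -(seminormZ N_seminorm) -(seminormN N_seminorm (_ *: y)).
  suff -> : p - b *: y - best b' =
      p - b' *: y - best b' + - ((b - b') *: y) by exact: seminormD.
  by rewrite scalerBl opprB [RHS]addrAC addrA subrK.
have [Ny0|Ny0] := eqVneq (N y) 0.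
  by exists 0 => b; have := fle 0 b; rewrite Ny0 mulr0 addr0.
apply: (@lipschitz_coercive_min f (N y) (N p)) => [|b b'|b].
- by rewrite lt_neqAle eq_sym Ny0 (seminorm_ge0 N_seminorm).
- rewrite ler_norml; apply/andP; split.
    by have := fle b' b; rewrite distrC; lra.
  by have := fle b b'; lra.
- have [S'b _] := best_min b; have := ydist b _ S'b.
  have -> : f b = N (b *: y + best b - p).
    by rewrite /f -addrA -opprD seminormC.
  have := ler_seminormB N_seminorm (b *: y + best b) p; lra.
Qed.

(** Two minimizers have a midpoint in [S]; were they at positive distance, the parallelogram
    inequality would make the midpoint strictly better. *)
Lemma best_approximation_unique (S : set E) (p s t : E) : hilbertian N ->
  submod_closed (mem S) ->
  argmin_on S (fun s => N (p - s)) s -> argmin_on S (fun s => N (p - s)) t ->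
  N (s - t) = 0.
Proof.
move=> hN [S0 SP] [Ss smin] [St tmin].
have sN := N_seminorm.
have Smid : S (2^-1 *: (s + t)).
  have := SP 1 s t; have := SP 2^-1 (s + t) 0.
  by rewrite scale1r addr0 !inE in S0 * => hZ hD; apply: hZ => //; exact: hD.
have st : N (p - s) = N (p - t) by apply/le_anti; rewrite smin// tmin.
have := smin _ Smid; have := hN (p - s) (p - t).
have -> : (p - s) + (p - t) = 2 *: (p - 2^-1 *: (s + t)).
  by rewrite scalerBr scalerA divff// scale1r opprD addrACA scaler_nat mulr2n.
have -> : (p - s) - (p - t) = t - s.
  by rewrite opprB addrC addrA subrK.
rewrite (seminormZ sN) (ger0_norm (ler0n R 2)) -st (seminormC sN t) => par mid.
have := seminorm_ge0 sN (p - s); have := seminorm_ge0 sN (s - t).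
by move: par mid; nra.
Qed.

(** A Cea-type estimate: [s] is a best approximation of the data [p] for the
    computable seminorm [M], and is compared in the target seminorm [N] with an
    arbitrary [t] in [S].  The bound [N <= k * M] is applied to [t - s] only,
    which is why it may be restricted to [S]. *)
Lemma quasi_best_approximation (M : E -> R) (S : set E) (k l : R) (p u s t : E) :
  seminorm M -> submod_closed (mem S) -> 0 <= k -> 0 <= l ->
  (forall x, S x -> N x <= k * M x) -> (forall x, M x <= l * N x) ->
  argmin_on S (fun s => M (p - s)) s -> S t ->
  N (u - s) <= (1 + 2 * k * l) * (N (u - p) + N (u - t)).
Proof.
move=> sM [_ SP] k0 l0 NM MN [Ss smin] St.
have Sts : S (t - s).
  by have := SP (-1) s t; rewrite !inE scaleN1r addrC; exact.
have sN := N_seminorm.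
have step1 := seminorm_trans sN t u s.
have step2 := NM _ Sts.
have step3 : M (t - s) <= 2 * M (p - t).
  have := seminorm_trans sM p t s; have := smin _ St.
  by rewrite (seminormC sM t p); lra.
have step4 := MN (p - t).
have step5 := seminorm_trans sN u p t; rewrite (seminormC sN p u) in step5.
have step6 : k * M (t - s) <= 2 * k * l * (N (u - p) + N (u - t)).
  rewrite -!mulrA (mulrCA 2) ler_wpM2l// (le_trans step3)//.
  by rewrite ler_wpM2l// (le_trans step4)// ler_wpM2l.
have := seminorm_ge0 sN (u - p); lra.
Qed.

End BestApproximation.

(** * The dual seminorm of a discrete test space *)

Section DualSeminorm.
Set Implicit Arguments.
Unset Strict Implicit.
Variables (R : realType) (Y : hilbertType R) (S : set Y) (nu : Y -> R).

(** The supremum is taken over squares, as in the objective functional, so that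
    [dual_seminorm_sqr] identifies the first term of the objective; the square
    root turns it into a seminorm. *)
Definition dual_seminorm (l : dual Y) : R :=
  Num.sqrt (sup [set `|l v| ^+ 2 / nu v ^+ 2 | v in nonzero S]).

Variable c : R.
Hypothesis c_gt0 : 0 < c.
Hypothesis nu_ge : forall v, S v -> c * `|v| <= nu v.

Let nu_gt0 v : nonzero S v -> 0 < nu v.
Proof.
move=> [Sv /= v0]; rewrite (lt_le_trans _ (nu_ge Sv))//.
by rewrite mulr_gt0 ?normr_gt0.
Qed.

Let dual_ubound (l : dual Y) :
  has_ubound [set `|l v| ^+ 2 / nu v ^+ 2 | v in nonzero S].
Proof.
exists ((`|l| / c) ^+ 2) => _ [v Sv <-].
have nv := nu_gt0 Sv; case: Sv => Sv _.
rewrite -expr_div_n lerXn2r ?nnegrE ?divr_ge0 ?(ltW nv) ?(ltW c_gt0)//.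
rewrite ler_pdivrMr// mulrAC ler_pdivlMr//.
rewrite (le_trans (ler_wpM2r (ltW c_gt0) (op_normP l v)))// -mulrA.
by rewrite ler_wpM2l ?op_norm_ge0// mulrC nu_ge.
Qed.

Lemma dual_seminorm_sqr (l : dual Y) :
  dual_seminorm l ^+ 2 = sup [set `|l v| ^+ 2 / nu v ^+ 2 | v in nonzero S].
Proof.
rewrite sqr_sqrtr//.
have [->|/set0P[y Sy]] :=
  eqVneq [set `|l v| ^+ 2 / nu v ^+ 2 | v in nonzero S] set0.
  by rewrite sup0.
apply: le_trans (ub_le_sup (dual_ubound l) Sy).
by case: Sy => v _ <-; rewrite divr_ge0 ?sqr_ge0.
Qed.

Lemma dual_seminormP (l : dual Y) v : S v -> `|l v| <= dual_seminorm l * nu v.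
Proof.
move=> Sv; have [v0E|v0] := eqVneq v 0.
  rewrite {1}v0E linear0 normr0 mulr_ge0 ?sqrtr_ge0//.
  by apply: le_trans (nu_ge Sv); rewrite v0E normr0 mulr0.
have nv : 0 < nu v by apply: nu_gt0.
rewrite -ler_pdivrMr// -(ler_pXn2r (ltn0Sn 1)) ?nnegrE ?sqrtr_ge0//; last first.
  by rewrite divr_ge0 ?(ltW nv).
rewrite dual_seminorm_sqr expr_div_n.
by apply: (ub_le_sup (dual_ubound l)); exists v.
Qed.

Lemma dual_seminorm_sqr_le (l : dual Y) K : 0 <= K ->
  (forall v, nonzero S v -> `|l v| ^+ 2 <= K * nu v ^+ 2) ->
  dual_seminorm l ^+ 2 <= K.
Proof.
move=> K0 lK; rewrite dual_seminorm_sqr.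
have [->|/set0P T0] :=
  eqVneq [set `|l v| ^+ 2 / nu v ^+ 2 | v in nonzero S] set0.
  by rewrite sup0.
apply: ge_sup => // _ [v Sv <-].
by rewrite ler_pdivrMr ?exprn_gt0 ?nu_gt0// lK.
Qed.

Lemma dual_seminorm_le (l : dual Y) K : 0 <= K ->
  (forall v, nonzero S v -> `|l v| <= K * nu v) -> dual_seminorm l <= K.
Proof.
move=> K0 lK; rewrite -(ler_pXn2r (ltn0Sn 1)) ?nnegrE ?sqrtr_ge0//.
apply: dual_seminorm_sqr_le => [|v Sv]; first exact: sqr_ge0.
rewrite -exprMn ler_pXn2r ?nnegrE ?normr_ge0 ?mulr_ge0 ?lK//.
by rewrite ltW ?nu_gt0.
Qed.

Lemma dual_seminorm_ge0 (l : dual Y) : 0 <= dual_seminorm l.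
Proof. exact: sqrtr_ge0. Qed.

Lemma dual_seminorm_le_norm (l : dual Y) : dual_seminorm l <= c^-1 * `|l|.
Proof.
apply: dual_seminorm_le => [|v [Sv _]].
  by rewrite mulr_ge0 ?invr_ge0 ?(ltW c_gt0).
rewrite (le_trans (op_normP l v))// mulrAC [leRHS]mulrC.
by rewrite ler_wpM2l ?op_norm_ge0// ler_pdivlMl// nu_ge.
Qed.

Lemma dual_seminorm_seminorm : seminorm dual_seminorm.
Proof.
have Zle a l : dual_seminorm (a *: l) <= `|a| * dual_seminorm l.
  apply: dual_seminorm_le => [|v [Sv _]].
    by rewrite mulr_ge0 ?dual_seminorm_ge0.
  rewrite [X in `|X|](_ : _ = a * l v)// normrM -mulrA ler_wpM2l//.
  exact: dual_seminormP.
split=> [l m|a l].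
  apply: dual_seminorm_le => [|v [Sv _]].
    by rewrite addr_ge0 ?dual_seminorm_ge0.
  rewrite mulrDl (le_trans (ler_normD _ _))//.
  by rewrite lerD ?dual_seminormP.
apply/le_anti; rewrite Zle/=.
have [->|a0] := eqVneq a 0.
  by rewrite normr0 mul0r dual_seminorm_ge0.
rewrite -{1}(scalerK a0 l) -ler_pdivlMl ?normr_gt0// -normfV.
exact: Zle.
Qed.

(** For test vectors [v] and [w],
    [(l + m) v + (l - m) w = l (v + w) + m (v - w)], whose square is at most
    [K * (nu v ^+ 2 + nu w ^+ 2)], with [K := 2 * (q l ^+ 2 + q m ^+ 2)] and [q]
    the dual seminorm, by Cauchy-Schwarz and the parallelogram inequality for
    [nu].  Optimizing the lengths of [v] and [w] and then taking the suprema
    over [v] and [w] independently bounds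
    [q (l + m) ^+ 2 + q (l - m) ^+ 2] by [K]. *)
Lemma dual_seminorm_hilbertian : submod_closed (mem S) ->
  (forall v w, S v -> S w ->
    nu (v + w) ^+ 2 + nu (v - w) ^+ 2 <= 2 * (nu v ^+ 2 + nu w ^+ 2)) ->
  (forall a v, S v -> nu (a *: v) ^+ 2 = a ^+ 2 * nu v ^+ 2) ->
  hilbertian dual_seminorm.
Proof.
move=> [S0 SP] nu_par nuZ l m.
have SD a v w : S v -> S w -> S (a *: v + w).
  by move: (SP a v w); rewrite !inE.
rewrite inE in S0.
have SZ a v : S v -> S (a *: v).
  by move=> Sv; rewrite -[_ *: v]addr0; exact: SD.
set K := 2 * _.
have K0 : 0 <= K by rewrite mulr_ge0 ?addr_ge0 ?sqr_ge0.
have test v w : S v -> S w ->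
    ((l + m) v + (l - m) w) ^+ 2 <= K * (nu v ^+ 2 + nu w ^+ 2).
  move=> Sv Sw.
  have -> : (l + m) v + (l - m) w = l (v + w) + m (v - w).
    rewrite linearD linearB/=.
    change ((l v + m v) + (l w - m w) = l v + l w + (m v - m w)); ring.
  have Svw : S (v + w) by have := SD 1 v w Sv Sw; rewrite scale1r.
  have Svw' : S (v - w).
    by have := SD (-1) w v Sw Sv; rewrite scaleN1r addrC.
  have lx := dual_seminormP l Svw; have my := dual_seminormP m Svw'.
  have : (l (v + w) + m (v - w)) ^+ 2 <=
      (dual_seminorm l * nu (v + w) + dual_seminorm m * nu (v - w)) ^+ 2.
    rewrite -[leLHS]real_normK ?num_real// lerXn2r ?nnegrE ?normr_ge0//.
      by apply: le_trans (lerD lx my); rewrite addr_ge0.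
    exact: le_trans (ler_normD _ _) (lerD lx my).
  move/le_trans; apply.
  apply: (@le_trans _ _ ((dual_seminorm l ^+ 2 + dual_seminorm m ^+ 2) *
      (nu (v + w) ^+ 2 + nu (v - w) ^+ 2))).
    rewrite -subr_ge0; set d := _ - _.
    have -> : d = (dual_seminorm l * nu (v - w) - dual_seminorm m * nu (v + w)) ^+ 2.
      by rewrite /d; ring.
    exact: sqr_ge0.
  rewrite /K -mulrA mulrCA ler_wpM2l ?addr_ge0 ?sqr_ge0//.
  exact: nu_par.
have ratio_le v w : nonzero S v -> nonzero S w ->
    `|(l + m) v| ^+ 2 / nu v ^+ 2 + `|(l - m) w| ^+ 2 / nu w ^+ 2 <= K.
  move=> nzv nzw; have nv := nu_gt0 nzv; have nw := nu_gt0 nzw.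
  case: nzv nzw => Sv _ [Sw _].
  (* [test] at the rescaled vectors reads [s ^+ 2 <= K * s], where [s] is the
     sum to be bounded. *)
  have homog (f : dual Y) a x : f (a *: x) = a * f x by exact: linearZ.
  have := test _ _ (SZ ((l + m) v / nu v ^+ 2) v Sv)
    (SZ ((l - m) w / nu w ^+ 2) w Sw).
  rewrite !nuZ// !homog !real_normK ?num_real//.
  set r := (l + m) v; set t := (l - m) w.
  set s := r ^+ 2 / nu v ^+ 2 + t ^+ 2 / nu w ^+ 2.
  have -> : r / nu v ^+ 2 * r + t / nu w ^+ 2 * t = s.
    by rewrite /s; ring.
  have -> : (r / nu v ^+ 2) ^+ 2 * nu v ^+ 2 +
      (t / nu w ^+ 2) ^+ 2 * nu w ^+ 2 = s.
    by rewrite /s; field; rewrite !lt0r_neq0.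
  have : 0 <= s by rewrite addr_ge0 ?divr_ge0 ?sqr_ge0.
  rewrite expr2 le_eqVlt => /orP[/eqP<-//|s0].
  by rewrite ler_pM2r.
have sup_le w : nonzero S w ->
    dual_seminorm (l + m) ^+ 2 + `|(l - m) w| ^+ 2 / nu w ^+ 2 <= K.
  move=> Sw; rewrite -lerBrDr; apply: dual_seminorm_sqr_le => [|v Sv].
    have := ratio_le _ _ Sw Sw; rewrite subr_ge0; apply: le_trans.
    by rewrite lerDr divr_ge0 ?sqr_ge0.
  by rewrite -ler_pdivrMr ?exprn_gt0 ?nu_gt0// lerBrDr ratio_le.
rewrite addrC -lerBrDr; apply: dual_seminorm_sqr_le => [|w Sw].
  rewrite subr_ge0; apply: dual_seminorm_sqr_le => // v Sv.
  rewrite -ler_pdivrMr ?exprn_gt0 ?nu_gt0// (le_trans _ (ratio_le _ _ Sv Sv))//.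
  by rewrite lerDl divr_ge0 ?sqr_ge0.
by rewrite -ler_pdivrMr ?exprn_gt0 ?nu_gt0// lerBrDr addrC sup_le.
Qed.

End DualSeminorm.

(** * The norm of an inner product given on a subspace *)

Section InnerProductNorm.
Set Implicit Arguments.
Unset Strict Implicit.
Variables (R : realType) (E : lmodType R) (S : set E) (ip : E -> E -> R).
Hypothesis S_submod : submod_closed (mem S).
Hypothesis ip_inner : inner_product_on S ip.

Let SP a v w : S v -> S w -> S (a *: v + w).
Proof. by case: S_submod => _ /(_ a v w); rewrite !inE. Qed.

Let S0 : S 0.
Proof. by case: S_submod; rewrite inE. Qed.

Let ipP a u v w : S u -> S v -> S w -> ip (a *: u + v) w = a * ip u w + ip v w.
Proof. by case: ip_inner => _ + _ => /(_ u v w); rewrite !inE => H *; exact: H. Qed.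

Let ipC u v : S u -> S v -> ip u v = ip v u.
Proof. by case: ip_inner => + _ _ => /(_ u v); rewrite !inE => H *; exact: H. Qed.

Let ip0 w : S w -> ip 0 w = 0.
Proof. by move=> Sw; have := ipP 1 S0 S0 Sw; rewrite scaler0 addr0; lra. Qed.

Let ip_norm_sqr v : S v -> ip_norm ip v ^+ 2 = ip v v.
Proof.
move=> Sv; rewrite sqr_sqrtr//.
have [->|v0] := eqVneq v 0; first by rewrite ip0.
by apply/ltW; case: ip_inner => _ _; apply; rewrite ?inE.
Qed.

Lemma ip_norm_parallelogram v w : S v -> S w ->
  ip_norm ip (v + w) ^+ 2 + ip_norm ip (v - w) ^+ 2 =
  2 * (ip_norm ip v ^+ 2 + ip_norm ip w ^+ 2).
Proof.
move=> Sv Sw.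
have expand a : ip_norm ip (a *: w + v) ^+ 2 =
    a ^+ 2 * ip w w + 2 * a * ip v w + ip v v.
  have Swv := SP a Sw Sv.
  rewrite ip_norm_sqr// ipP// !(ipC _ Swv)// !ipP// (ipC Sw Sv); ring.
have -> : v + w = 1 *: w + v by rewrite scale1r addrC.
have -> : v - w = -1 *: w + v by rewrite scaleN1r addrC.
by rewrite !expand !ip_norm_sqr//; ring.
Qed.

Lemma ip_norm_sqrZ a v : S v -> ip_norm ip (a *: v) ^+ 2 = a ^+ 2 * ip_norm ip v ^+ 2.
Proof.
move=> Sv; have Sav : S (a *: v) by rewrite -[_ *: v]addr0; exact: SP.
have ipZ w : S w -> ip (a *: v) w = a * ip v w.
  by move=> Sw; rewrite -[_ *: v]addr0 ipP// ip0// addr0.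
by rewrite !ip_norm_sqr// ipZ// ipC// ipZ// mulrA.
Qed.

End InnerProductNorm.

(** * The inf-sup condition and the stacked least-squares problem *)

Section InfSup.
Set Implicit Arguments.
Unset Strict Implicit.
Variables (R : realType) (X Y : hilbertType R) (B : 'L(X, dual Y)).

(** Any real number strictly between 0 and [varrho] is a uniform inf-sup
    constant, and strictness lets the supremum be witnessed by one test
    vector. *)
Lemma varrho_gt0_inf_sup (Delta : Type) (Xd : Delta -> set X)
    (Yd : Delta -> set Y) : (0 < varrho B Xd Yd)%E ->
  exists2 r : R, 0 < r & forall d z, Xd d z -> B z != 0 ->
    exists2 v, nonzero (Yd d) v & r * (`|B z| * `|v|) <= `|B z v|.
Proof.
move=> rho0; have [r r0 r_lt] : exists2 r : R, 0 < r & (r%:E < varrho B Xd Yd)%E.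
  move: rho0; case: (varrho B Xd Yd) => [s|_|//].
    by rewrite lte_fin => s0; exists (s / 2); rewrite ?lte_fin; lra.
  (* [varrho] is [+oo] when [B] vanishes on every trial space. *)
  by exists 1; rewrite ?ltry.
exists r => // d z Xz Bz0.
pose quotients z :=
  [set (`|B z v| / (`|B z| * `|v|))%:E | v in nonzero (Yd d)].
have : (r%:E < ereal_sup (quotients z))%E.
  apply: (lt_le_trans r_lt).
  pose sups := [set ereal_sup (quotients z) | z in Xd d `&` [set z | B z != 0]].
  apply: (@le_trans _ _ (ereal_inf sups)); apply: ereal_inf_lbound.
    by exists d.
  by exists z.
move=> /ereal_sup_gt[_ [v nzv <-]]; rewrite lte_fin => /ltW rv.
exists v => //; move: rv; rewrite ler_pdivlMr// mulr_gt0 ?normr_gt0//.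
by case: nzv.
Qed.

End InfSup.

Section LeastSquares.
Set Implicit Arguments.
Unset Strict Implicit.
Variables (R : realType) (X Y W H : hilbertType R).
Variables (B : 'L(X, dual Y)) (C : 'L(X, W)) (L : 'L(X, H)).
Variable eps : R.
Hypothesis eps_gt0 : 0 < eps.

Definition stacked (z : X) : dual Y * W * H := (B z, C z, eps *: L z).

Definition stacked_seminorm (q : dual Y -> R) : dual Y * W * H -> R :=
  l2_sum (l2_sum q (fun w : W => `|w|)) (fun x : H => `|x|).

Let stacked_linear a x y : stacked (a *: x + y) = a *: stacked x + stacked y.
Proof. by rewrite /stacked !linearP. Qed.

Let stackedB x y : stacked (x - y) = stacked x - stacked y.
Proof. by rewrite addrC -scaleN1r stacked_linear scaleN1r addrC. Qed.

Let stacked0 : stacked 0 = 0.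
Proof. by rewrite -(subrr 0) stackedB subrr. Qed.

Let stacked_inj : injective (fun x : X => (B x, C x, L x)) -> injective stacked.
Proof.
move=> BCL x y [Bxy Cxy Lxy]; apply: BCL; congr (_, _, _) => //.
exact: (scalerI (lt0r_neq0 eps_gt0)).
Qed.

Lemma stacked_seminorm_seminorm q : seminorm q -> seminorm (stacked_seminorm q).
Proof.
move=> sq; apply: l2_sum_seminorm; last exact: normr_seminorm.
by apply: l2_sum_seminorm => //; exact: normr_seminorm.
Qed.

Lemma stacked_seminorm_hilbertian q :
  hilbertian q -> hilbertian (stacked_seminorm q).
Proof.
move=> hq; apply: l2_sum_hilbertian; last exact: hilbert_norm_hilbertian.
by apply: l2_sum_hilbertian => //; exact: hilbert_norm_hilbertian.
Qed.

Lemma energy_normE z :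
  energy_norm B C L eps z = stacked_seminorm (fun l => `|l|) (stacked z).
Proof.
rewrite /energy_norm /stacked_seminorm /l2_sum /=.
by rewrite sqr_sqrtr ?addr_ge0 ?sqr_ge0// normrZ exprMn real_normK ?num_real.
Qed.

Lemma findim_stacked S : findim_subspace S -> findim_subspace (stacked @` S).
Proof.
move=> [[S0 SP] [n [e Se]]]; split; first split.
- by rewrite inE in S0; rewrite inE; exists 0; rewrite ?stacked0.
- move=> a _ _ /set_mem[x Sx <-] /set_mem[y Sy <-].
  rewrite inE; exists (a *: x + y); last by rewrite stacked_linear.
  by have := SP a x y; rewrite !inE; exact.
exists n, (fun i => stacked (e i)) => _ [x /Se[c ->] <-]; exists c.
elim/big_ind2: _ => [|_ y _ z <- <-|i _].
- exact: stacked0.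
- by rewrite -[y]scale1r stacked_linear !scale1r.
- by rewrite -[c i *: e i]addr0 stacked_linear stacked0 addr0.
Qed.

Lemma energy_best_approximation S u : findim_subspace S ->
  exists2 t, S t & is_min [set energy_norm B C L eps (u - z) | z in S]
                     (energy_norm B C L eps (u - t)).
Proof.
move=> Sfin.
have [_ [[t St <-] tmin]] := best_approximation
  (stacked_seminorm_seminorm (@normr_seminorm R (dual Y)))
  (stacked u) (findim_stacked Sfin).
exists t => //; split; first by exists t.
move=> _ [z Sz <-]; rewrite !energy_normE !stackedB.
by apply: tmin; exists z.
Qed.

Section Discrete.
Variables (Xd : set X) (Yd : set Y) (ip : Y -> Y -> R) (c C0 r : R).
Hypothesis Xd_findim : findim_subspace Xd.
Hypothesis Yd_submod : submod_closed (mem Yd).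
Hypothesis ip_inner : inner_product_on Yd ip.
Hypothesis c_gt0 : 0 < c.
Hypothesis ip_norm_ge : forall v, Yd v -> c * `|v| <= ip_norm ip v.
Hypothesis ip_norm_le : forall v, Yd v -> ip_norm ip v <= C0 * `|v|.
Hypothesis r_gt0 : 0 < r.
Hypothesis C0_gt0 : 0 < C0.
Hypothesis inf_sup : forall z, Xd z -> B z != 0 ->
  exists2 v, nonzero Yd v & r * (`|B z| * `|v|) <= `|B z v|.

Let q := dual_seminorm Yd (ip_norm ip).
Let Nd := stacked_seminorm q.
Let N := stacked_seminorm (fun l => `|l|).

Let q_seminorm : seminorm q := dual_seminorm_seminorm c_gt0 ip_norm_ge.
Let Nd_seminorm : seminorm Nd := stacked_seminorm_seminorm q_seminorm.
Let N_seminorm : seminorm N := stacked_seminorm_seminorm (@normr_seminorm R (dual Y)).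

(** The inf-sup condition says that testing [B z] on [Yd] loses only a bounded
    factor. *)
Lemma norm_le_dual_seminorm z : Xd z -> `|B z| <= C0 / r * q (B z).
Proof.
move=> Xz; have [->|Bz0] := eqVneq (B z) 0.
  by rewrite normr0 mulr_ge0 ?(seminorm_ge0 q_seminorm)// divr_ge0 ?ltW.
have [v [Yv /= v0] rv] := inf_sup Xz Bz0.
rewrite mulrAC ler_pdivlMr// mulrC -(ler_pM2r (_ : 0 < `|v|)) ?normr_gt0//.
rewrite -mulrA (le_trans rv)// (le_trans (dual_seminormP c_gt0 ip_norm_ge _ Yv))//.
by rewrite mulrAC mulrC ler_wpM2r ?ip_norm_le// (seminorm_ge0 q_seminorm).
Qed.

Let l2_le (q1 q2 : dual Y -> R) k p : 0 <= k ->
  0 <= q1 p.1.1 -> 0 <= q2 p.1.1 -> q1 p.1.1 <= k * q2 p.1.1 ->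
  stacked_seminorm q1 p <= (1 + k) * stacked_seminorm q2 p.
Proof.
case: p => [[l w] x] /= k0 q10 q20 q12.
have k1 : 0 <= 1 + k by rewrite addr_ge0.
have le1 (a : R) : 0 <= a -> a <= (1 + k) * a.
  by move=> a0; rewrite ler_peMl// lerDl.
apply: l2_sum_le => //; rewrite ?sqrtr_ge0 ?le1//.
apply: l2_sum_le => //; rewrite ?le1//.
by rewrite (le_trans q12)// ler_wpM2r// lerDr.
Qed.

Lemma stacked_norm_le_discrete s : (stacked @` Xd) s -> N s <= (1 + C0 / r) * Nd s.
Proof.
move=> [z Xz <-]; apply: l2_le => //=.
- by rewrite divr_ge0 ?ltW.
- exact: seminorm_ge0 q_seminorm _.
- exact: norm_le_dual_seminorm.
Qed.

Lemma discrete_le_stacked_norm s : Nd s <= (1 + c^-1) * N s.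
Proof.
apply: l2_le => //=.
- by rewrite invr_ge0 ltW.
- exact: seminorm_ge0 q_seminorm _.
- exact: dual_seminorm_le_norm.
Qed.

Lemma objectiveE g h z : objective B C L Yd ip eps g h z =
  Nd ((g, h, 0) - stacked z) ^+ 2.
Proof.
rewrite (seminormC Nd_seminorm) /Nd /stacked_seminorm /l2_sum /=.
rewrite 2?sqr_sqrtr ?addr_ge0 ?sqr_ge0// /objective /q.
rewrite (dual_seminorm_sqr c_gt0 ip_norm_ge) subr0 normrZ exprMn.
by rewrite real_normK ?num_real.
Qed.

(** Minimizing the objective is best approximation of the data in the stacked
    space.  The membership of [ud] is kept apart: that [stacked ud] lies in the
    image only says that some element of [Xd] has the same image. *)
Lemma argmin_objective g h ud :
  argmin_on Xd (objective B C L Yd ip eps g h) ud <->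
  Xd ud /\ argmin_on (stacked @` Xd) (fun s => Nd ((g, h, 0) - s)) (stacked ud).
Proof.
have le z z' : (objective B C L Yd ip eps g h z <= objective B C L Yd ip eps g h z')
   = (Nd ((g, h, 0) - stacked z) <= Nd ((g, h, 0) - stacked z')).
  by rewrite !objectiveE ler_pXn2r// nnegrE (seminorm_ge0 Nd_seminorm).
split=> [[Xud udmin]|[Xud [_ udmin]]].
  split=> //; split; first by exists ud.
  by move=> _ [z Xz <-]; rewrite -le; exact: udmin.
by split=> // z Xz; rewrite le; apply: udmin; exists z.
Qed.

Lemma discrete_minimizer_unique_exists g h :
  injective (fun x : X => (B x, C x, L x)) ->
  exists! ud, argmin_on Xd (objective B C L Yd ip eps g h) ud.
Proof.
move=> BCL_inj.
have Sfin := findim_stacked Xd_findim; have [Ssub _] := Sfin.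
have [_ [[ud Xud <-] udmin]] := best_approximation Nd_seminorm (g, h, 0) Sfin.
have ud_argmin : argmin_on Xd (objective B C L Yd ip eps g h) ud.
  by apply/argmin_objective; split=> //; split=> //; exists ud.
exists ud; split=> // w /argmin_objective[Xw wmin].
move/argmin_objective: ud_argmin => [_ {}udmin].
apply: (stacked_inj BCL_inj); apply/subr0_eq.
have hNd : hilbertian Nd.
  apply: stacked_seminorm_hilbertian.
  apply: (dual_seminorm_hilbertian c_gt0 ip_norm_ge Yd_submod).
    move=> v v' Yv Yv'.
    by rewrite (ip_norm_parallelogram Yd_submod ip_inner Yv Yv').
  by move=> a v; exact: (ip_norm_sqrZ Yd_submod ip_inner).
(* [Nd] is only a seminorm, but it dominates [N] on the image of [Xd]. *)
have Nd0 := best_approximation_unique Nd_seminorm hNd Ssub udmin wmin.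
have N0 : N (stacked ud - stacked w) = 0.
  apply/le_anti; rewrite (seminorm_ge0 N_seminorm) andbT.
  rewrite -(mulr0 (1 + C0 / r)) -Nd0 stacked_norm_le_discrete// -stackedB.
  exists (ud - w) => //; case: Xd_findim => -[_ XP] _.
  by have := XP (-1) w ud; rewrite !inE scaleN1r addrC; exact.
move: (_ - _) N0 => [[l k] x] /l2_sum_eq0[/l2_sum_eq0[/=]].
by move=> /normr0_eq0-> /normr0_eq0-> /normr0_eq0->.
Qed.

Lemma discrete_error g h u ud :
  argmin_on Xd (objective B C L Yd ip eps g h) ud ->
  exists2 m : R, is_min [set energy_norm B C L eps (u - z) | z in Xd] m &
    energy_norm B C L eps (u - ud) <=
      (1 + 2 * (1 + C0 / r) * (1 + c^-1)) *
      (`|B u - g| + `|C u - h| + m + eps * `|L u|).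
Proof.
move=> /argmin_objective[Xud udmin].
have [t Xt tmin] := energy_best_approximation u Xd_findim.
eexists; first exact: tmin.
have Sfin := findim_stacked Xd_findim; have [Ssub _] := Sfin.
have k0 : 0 <= 1 + C0 / r by rewrite addr_ge0 ?divr_ge0 ?ltW.
have l0 : 0 <= 1 + c^-1 by rewrite addr_ge0 ?invr_ge0 ?ltW.
have St : (stacked @` Xd) (stacked t) by exists t.
have := quasi_best_approximation N_seminorm (stacked u) Nd_seminorm Ssub k0 l0
  stacked_norm_le_discrete discrete_le_stacked_norm udmin St.
rewrite !energy_normE !stackedB => /le_trans; apply.
apply: ler_wpM2l; first by rewrite addr_ge0 ?mulr_ge0.
rewrite -addrA (addrC (N _)) -/N [leRHS]addrCA.
have data_misfit : N (stacked u - (g, h, 0)) <=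
    `|B u - g| + `|C u - h| + eps * `|L u|.
  apply: le_trans (l2_sum_le_add _ _) _ => //; first exact: sqrtr_ge0.
  apply: lerD; last by rewrite /= subr0 normrZ gtr0_norm.
  exact: l2_sum_le_add.
lra.
Qed.

End Discrete.
End LeastSquares.

(** * The regularized least-squares error estimate *)

Theorem theorem4p1 (R : realType) (X Y W H : hilbertType R)
    (B : 'L(X, dual Y)) (C : 'L(X, W)) (L : 'L(X, H))
    (BCL_inj : injective (fun x : X => (B x, C x, L x)))
    (Delta : Type) (Xd : Delta -> set X) (Yd : Delta -> set Y)
    (Xd_findim : forall d, findim_subspace (Xd d))
    (Yd_findim : forall d, findim_subspace (Yd d))
    (varrho_gt0 : (0 < varrho B Xd Yd)%E)
    (ip : Delta -> Y -> Y -> R)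
    (ip_inner : forall d, inner_product_on (Yd d) (ip d))
    (ip_equiv : exists c C0 : R, [/\ 0 < c, c <= C0 &
       forall d v, Yd d v ->
         c * `|v| <= ip_norm (ip d) v /\ ip_norm (ip d) v <= C0 * `|v|]) :
  [/\ (forall (d : Delta) (eps : R) (g : dual Y) (h : W), 0 < eps ->
         exists! ud : X,
           argmin_on (Xd d) (objective B C L (Yd d) (ip d) eps g h) ud),
      (exists K : R,
         forall (d : Delta) (eps : R) (g : dual Y) (h : W) (u ud : X),
         0 < eps ->
         argmin_on (Xd d) (objective B C L (Yd d) (ip d) eps g h) ud ->
         exists2 m : R,
           is_min [set energy_norm B C L eps (u - z) | z in Xd d] m &
           energy_norm B C L eps (u - ud) <=
             K * (`|B u - g| + `|C u - h| + m + eps * `|L u|)) &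
      (exists K' : R,
         forall (d : Delta) (eps : R) (g : dual Y) (h : W) (u ud : X) (tau : R),
         0 < eps ->
         argmin_on (Xd d) (objective B C L (Yd d) (ip d) eps g h) ud ->
         pair_norm ((g, h) - (B u, C u)) <= tau ->
         exists2 m : R,
           is_min [set energy_norm B C L eps (u - z) | z in Xd d] m &
           energy_norm B C L eps (u - ud) <=
             K' * (tau + m + eps * `|L u|))].
Proof.
have [c [C0 [c0 cC0 ip_bounds]]] := ip_equiv.
have C00 : 0 < C0 := lt_le_trans c0 cC0.
have [r r0 inf_sup] := varrho_gt0_inf_sup varrho_gt0.
have ip_ge d v : Yd d v -> c * `|v| <= ip_norm (ip d) v.
  by move=> /ip_bounds[].
have ip_le d v : Yd d v -> ip_norm (ip d) v <= C0 * `|v|.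
  by move=> /ip_bounds[].
have Yd_submod d : submod_closed (mem (Yd d)) by case: (Yd_findim d).
pose K := 1 + 2 * (1 + C0 / r) * (1 + c^-1).
have K0 : 0 <= K.
  by rewrite !(addr_ge0, mulr_ge0)// ?divr_ge0 ?invr_ge0 ?ltW.
have error d eps g h u ud : 0 < eps ->
    argmin_on (Xd d) (objective B C L (Yd d) (ip d) eps g h) ud ->
    exists2 m, is_min [set energy_norm B C L eps (u - z) | z in Xd d] m &
      energy_norm B C L eps (u - ud) <=
        K * (`|B u - g| + `|C u - h| + m + eps * `|L u|).
  move=> eps0; apply: (discrete_error eps0 (Xd_findim d) c0) => //.
  - exact: ip_ge.
  - exact: ip_le.
  - by move=> z; exact: inf_sup.
split.
- move=> d eps g h eps0.
  apply: (discrete_minimizer_unique_exists eps0 (Xd_findim d) (Yd_submod d)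
    (ip_inner d) c0 (@ip_ge d) (@ip_le d) r0 C00) => //.
  by move=> z; exact: inf_sup.
- by exists K.
(* Each of the two misfits is at most their Euclidean norm, hence at most
   [tau]. *)
- exists (2 * K) => d eps g h u ud tau eps0 ud_argmin data_tau.
  have [m m_min err] := error d eps g h u ud eps0 ud_argmin.
  exists m => //; apply: (le_trans err).
  have [] := pair_norm_ge (g - B u) (h - C u).
  rewrite (distrC g) (distrC h) => /le_trans/(_ data_tau) gt.
  move=> /le_trans/(_ data_tau) ht.
  have m0 : 0 <= m by case: m_min => -[z _ <-] _; exact: sqrtr_ge0.
  have e0 : 0 <= eps * `|L u| by rewrite mulr_ge0// ltW.
  rewrite (mulrC 2) -mulrA ler_wpM2l//; lra.
Qed.
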